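(* Let $\theta=(\sqrt{5}-1)/2=0.618\ldots$. For every Brjuno number $x\in\mathcal{B}$ with $x\neq\theta$, one has $\Phi(x)>\Phi(\theta)$.
   Context: Let $X=\,]0,1[\,\setminus\mathbb{Q}$ and let $\alpha:X\to X$ be the Gauss map $\alpha(x)=\{1/x\}$, where $\{t\}$ is the fractional part of $t$. Its iterates are $\alpha_0(x)=x$, $\alpha_{k+1}(x)=\alpha_k(\alpha(x))$ for $k\geq 0$. Put $\beta_{-1}(x)=1$ and $\beta_k(x)=\prod_{j=0}^k\alpha_j(x)$ for $k\in\mathbb{N}=\{0,1,2,\dots\}$. The Brjuno function is defined for $x\in X$ as the sum (possibly $+\infty$) of the series with nonnegative terms $$\Phi(x)=\sum_{k\geq 0}\beta_{k-1}(x)\ln\big(1/\alpha_k(x)\big).$$ The set of Brjuno numbers is $\mathcal{B}=\{x\in X:\Phi(x)<+\infty\}$. *)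

(* Defs.v *)
From mathcomp Require Import all_boot all_order all_algebra.
From mathcomp Require Import all_classical all_reals all_analysis.

Set Implicit Arguments.
Unset Strict Implicit.
Unset Printing Implicit Defensive.

Import Order.TTheory GRing.Theory Num.Theory.

Local Open Scope classical_set_scope.
Local Open Scope ring_scope.

(* The domain X = ]0,1[ \ Q.  The maps below are total functions on R, but they
   are only meaningful on X, which gauss_map maps into itself. *)
Definition gauss_domain {R : realType} : set R :=
  `]0, 1[ `&` @irrational R.

Definition gauss_map {R : realType} (x : R) : R :=
  x^-1 - (Num.floor x^-1)%:~R.

Definition gauss_iter {R : realType} (k : nat) (x : R) : R :=
  iter k gauss_map x.

(* Index shift: beta_pred k x is beta_{k-1}(x) = alpha_0(x) ... alpha_{k-1}(x),
   so that beta_pred 0 x is beta_{-1}(x) = 1. *)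
Definition beta_pred {R : realType} (k : nat) (x : R) : R :=
  \prod_(0 <= j < k) gauss_iter j x.

Definition brjuno_fun {R : realType} (x : R) : \bar R :=
  (\sum_(0 <= k <oo) (beta_pred k x * ln (gauss_iter k x)^-1)%:E)%E.

Definition brjuno_number {R : realType} : set R :=
  [set x | gauss_domain x /\ (brjuno_fun x < +oo)%E].

Definition theta {R : realType} : R := (Num.sqrt 5 - 1) / 2.

(* Main.v *)
Require Import Defs.
From mathcomp Require Import all_boot all_order all_algebra.
From mathcomp Require Import all_classical all_reals all_analysis.
From mathcomp Require Import ring lra.

(** Write m for -ln theta / (1 - theta).  As theta is fixed by the Gauss map
    alpha, the series at theta is geometric with sum m, so it suffices to show
    that Phi x > m for every x <> theta in the domain.

    The functional equation Phi x = - ln x + x * Phi (alpha x)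
    ([brjuno_fun_rec]) turns a lower bound a for Phi on the whole domain into
    the pointwise bound - ln x + x * a, and, when x > 1/2 (so that
    alpha x = 1/x - 1), after a second application into
    - ln x - x * ln (1/x - 1) + (1 - x) * a.  With a = m both bounds take the
    value m at theta; the first one exceeds m on the left of theta
    ([one_step_bound]) and the second one on the right ([two_step_bound]).
    Each of the two inequalities follows from the tangent line of ln and from
    - ln theta < theta.

    It remains to know that m itself is a lower bound.  With a = m - d, the
    coefficient of d in the two bounds is x <= theta on the left and
    1 - x <= theta on the right, so the lower bound m - d improves to
    m - theta * d ([brjuno_gap_contraction]).  Starting from Phi >= 0, that is
    d = m, iteration gives Phi >= m - theta ^ n * m for all n, hence
    Phi >= m.  One more use of the pointwise bounds, with a = m, makes the
    inequality strict away from theta. *)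

Import Order.TTheory GRing.Theory Num.Theory.
Import numFieldNormedType.Exports.
Local Open Scope classical_set_scope.
Local Open Scope ring_scope.

(** * The golden ratio and the tangent line of the logarithm *)

Lemma ln_le_tangent (R : realType) (a x : R) :
  0 < a -> 0 < x -> ln x <= ln a + (x - a) / a.
Proof.
move=> a0 x0.
have -> : ln x = ln a + ln (1 + (x - a) / a).
  rewrite -lnM ?posrE //.
    by congr ln; field; apply: lt0r_neq0.
  by rewrite (_ : 1 + _ = x / a) ?divr_gt0 //; field; apply: lt0r_neq0.
rewrite lerD2l; apply: le_ln1Dx.
rewrite (_ : (x - a) / a = x / a - 1); last by field; apply: lt0r_neq0.
by rewrite ltrDr divr_gt0.
Qed.

Lemma theta_sqr (R : realType) : (theta : R) ^+ 2 = 1 - theta.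
Proof.
have s : Num.sqrt (5 : R) ^+ 2 = 5 by rewrite sqr_sqrtr.
by rewrite /theta; set t := Num.sqrt 5 in s *; rewrite expr2 in s *; nra.
Qed.

Lemma theta_itv (R : realType) : 1 / 2 < (theta : R) < 1.
Proof.
have s : Num.sqrt (5 : R) ^+ 2 = 5 by rewrite sqr_sqrtr.
have s0 := sqrtr_ge0 (5 : R).
rewrite /theta; set t := Num.sqrt 5 in s s0 *; rewrite expr2 in s.
by apply/andP; split; nra.
Qed.

Lemma theta_inv (R : realType) : (theta : R)^-1 = 1 + theta.
Proof.
have /andP[h _] := theta_itv R; have e := theta_sqr R.
have t0 : (theta : R) != 0 by apply: lt0r_neq0; lra.
apply: (mulfI t0); rewrite divff //; rewrite expr2 in e; lra.
Qed.

(** As 1 / theta = 1 + theta, the lower bound is ln (1 + theta) < theta.  No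
    numerical value of ln theta enters the proof beyond this. *)
Lemma ln_theta (R : realType) : - theta < ln (theta : R) < 0.
Proof.
have /andP[h1 h2] := theta_itv R.
rewrite ln_lt0 ?andbT; last by apply/andP; split; lra.
rewrite ltrNl -lnV ?posrE; last by lra.
rewrite theta_inv.
rewrite -ltr_expR lnK ?posrE; last by lra.
apply: expR_gt1Dx; apply: lt0r_neq0; lra.
Qed.

(** * The minimal value and two elementary inequalities *)

(** The sum of the geometric series of ratio theta and first term - ln theta,
    which is the Brjuno function at theta. *)
Definition brjuno_min {R : realType} : R := - ln theta / (1 - theta).

Lemma brjuno_minE (R : realType) :
  - ln (theta : R) = brjuno_min * (1 - theta).
Proof.
have /andP[_ h] := theta_itv R.
by rewrite /brjuno_min divfK // lt0r_neq0 // subr_gt0.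
Qed.

Lemma brjuno_min_itv (R : realType) : 0 < (brjuno_min : R) < 1 + theta.
Proof.
have /andP[h1 h2] := theta_itv R; have /andP[l1 l2] := ln_theta R.
have e := theta_sqr R; rewrite expr2 in e; rewrite /brjuno_min.
have t1 : 0 < 1 - (theta : R) by lra.
by rewrite divr_gt0 ?oppr_gt0 //= ltr_pdivrMr //; nra.
Qed.

(** Both sides agree at theta, and the right-hand side lies above its tangent
    there, of slope brjuno_min - 1 / theta < 0. *)
Lemma one_step_bound (R : realType) (x : R) : 0 < x -> x < theta ->
  brjuno_min < - ln x + x * brjuno_min.
Proof.
move=> x0 xt.
have /andP[h1 h2] := theta_itv R; have /andP[m0 m1] := brjuno_min_itv R.
have t0 : 0 < (theta : R) by lra.
have := ln_le_tangent _ _ _ t0 x0; rewrite theta_inv.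
have := brjuno_minE R; nra.
Qed.

(** Since ln (1/x - 1) = ln (1 - x) - ln x, the difference of the two sides is
    - (1 - x) * ln x - x * ln (1 - x) - x * brjuno_min, which vanishes at theta
    because 1 - theta = theta ^ 2.  Bounding ln x by the tangent at theta and
    ln (1 - x) by the tangent at theta ^ 2 leaves a quadratic polynomial in x
    with the factor x - theta. *)
Lemma two_step_bound (R : realType) (x : R) : theta < x -> x < 1 ->
  brjuno_min < - ln x - x * ln (x^-1 - 1) + (1 - x) * brjuno_min.
Proof.
move=> xt x1.
have /andP[h1 h2] := theta_itv R; have /andP[m0 m1] := brjuno_min_itv R.
have t0 : 0 < (theta : R) by lra.
have x0 : 0 < x by lra.
have y0 : 0 < 1 - x by lra.
rewrite (_ : x^-1 - 1 = (1 - x) / x); last by field; apply: lt0r_neq0.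
rewrite ln_div ?posrE //.
have tx := ln_le_tangent _ _ _ t0 x0.
have ty : ln (1 - x) <= ln (theta ^+ 2) + (1 - x - theta ^+ 2) / theta ^+ 2.
  by apply: ln_le_tangent; rewrite ?exprn_gt0.
rewrite lnXn // -exprVn theta_inv theta_sqr in ty.
rewrite theta_inv in tx.
have e := theta_sqr R; have eL := brjuno_minE R.
rewrite expr2 in e.
set L := ln theta in tx ty eL *; set m := brjuno_min in m0 m1 eL *.
set t := theta in h1 h2 t0 xt tx ty e eL m1 *.
have bx : (1 - x) * ln x <= (1 - x) * (L + (x - t) * (1 + t)).
  by rewrite ler_pM2l.
have by_ : x * ln (1 - x) <= x * (L *+ 2 + (1 - x - (1 - t)) * (1 + t) ^+ 2).
  by rewrite ler_pM2l.
have key : 0 < - (1 - x) * (L + (x - t) * (1 + t))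
    - x * (L *+ 2 + (1 - x - (1 - t)) * (1 + t) ^+ 2) - x * m.
  rewrite (_ : _ - x * m =
     (x - t) * (x * (1 + t) ^+ 2 - (1 - x) * (1 + t) - m * t)).
    apply: mulr_gt0; first by lra.
    (* The second factor increases with x; at theta it is 1 - m * theta, which
       is positive because m < 1 + theta = 1 / theta. *)
    rewrite expr2; nra.
  have -> : L = - (m * (1 - t)) by lra.
  rewrite expr2 mulr2n; nra.
lra.
Qed.

(** * The Gauss map and the functional equation *)

Lemma gauss_domain_map (R : realType) (x : R) :
  gauss_domain x -> gauss_domain (gauss_map x).
Proof.
case=> /=; rewrite in_itv /= => /andP[x0 x1] xirr.
have airr : ~ rational (gauss_map x).
  move=> [q _ qE]; apply: xirr.
  exists ((q + (Num.floor x^-1)%:~R)^-1) => //.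
  by rewrite fmorphV rmorphD /= qE rmorph_int /gauss_map subrK invrK.
split; last exact: airr.
have /andP[f1 f2] := floor_itv x^-1.
rewrite /= in_itv /= lt_neqAle; apply/andP; split; last first.
  by rewrite /gauss_map; rewrite intrD in f2; lra.
apply/andP; split; last by rewrite /gauss_map subr_ge0.
apply/eqP => a0; apply: airr; exists 0 => //.
by rewrite -a0 rmorph0.
Qed.

Lemma gauss_domain_iter (R : realType) (x : R) k :
  gauss_domain x -> gauss_domain (gauss_iter k x).
Proof.
move=> xX; elim: k => [//|k IH].
by rewrite /gauss_iter iterS; apply: gauss_domain_map.
Qed.

Lemma gauss_map_half (R : realType) (x : R) :
  1 / 2 < x -> x < 1 -> gauss_map x = x^-1 - 1.
Proof.
move=> xh x1; have x0 : 0 < x by lra.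
rewrite /gauss_map (_ : Num.floor _ = 1) //; apply: floor_def.
rewrite invf_ge1 // ltW //=.
rewrite -(ltr_pM2r x0) mulVf ?lt0r_neq0 // intrD; lra.
Qed.

Lemma gauss_map_theta (R : realType) : gauss_map (theta : R) = theta.
Proof.
by have /andP[? ?] := theta_itv R; rewrite gauss_map_half // theta_inv addrC addKr.
Qed.

Lemma brjuno_term_ge0 (R : realType) (x : R) k : gauss_domain x ->
  0 <= beta_pred k x * ln (gauss_iter k x)^-1.
Proof.
move=> xX; have H j : 0 < gauss_iter j x < 1.
  by have [] := gauss_domain_iter _ _ j xX; rewrite /= in_itv.
apply: mulr_ge0.
  by apply: prodr_ge0 => j _; have /andP[/ltW] := H j.
by have /andP[? /ltW ?] := H k; apply: ln_ge0; rewrite invf_ge1.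
Qed.

Lemma brjuno_fun_ge0 (R : realType) (x : R) :
  gauss_domain x -> (0 <= brjuno_fun x)%E.
Proof.
by move=> xX; apply: nneseries_ge0 => k _ _; rewrite lee_fin brjuno_term_ge0.
Qed.

Lemma beta_predS (R : realType) (x : R) k :
  beta_pred k.+1 x = x * beta_pred k (gauss_map x).
Proof.
rewrite /beta_pred big_nat_recl //; congr (_ * _).
by apply: eq_bigr => j _; rewrite /gauss_iter iterSr.
Qed.

Lemma brjuno_fun_rec (R : realType) (x : R) : gauss_domain x ->
  brjuno_fun x = ((- ln x)%:E + x%:E * brjuno_fun (gauss_map x))%E.
Proof.
move=> xX; have [] := xX; rewrite /= in_itv /= => /andP[x0 _] _.
have aX := gauss_domain_map _ _ xX.
rewrite /brjuno_fun nneseries_recl //; last first.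
  by move=> k _; rewrite lee_fin brjuno_term_ge0.
congr (_ + _)%E.
  by rewrite /beta_pred big_geq // mul1r lnV.
rewrite -nneseriesZl; last by move=> k _; rewrite lee_fin brjuno_term_ge0.
rewrite -nneseries_addn; last by move=> k; rewrite lee_fin brjuno_term_ge0.
apply: eq_eseriesr => k _; rewrite addn1 -EFinM mulrA -beta_predS.
by rewrite /gauss_iter iterSr.
Qed.

(** The partial sums are those of a geometric series with nonnegative terms, so
    its sum bounds them. *)
Lemma brjuno_fun_theta_le (R : realType) :
  (brjuno_fun (theta : R) <= brjuno_min%:E)%E.
Proof.
have /andP[h1 h2] := theta_itv R; have /andP[_ l0] := ln_theta R.
have t0 : 0 < (theta : R) by lra.
have itE k : gauss_iter k (theta : R) = theta.
  by elim: k => // k IH; rewrite /gauss_iter iterS -/(gauss_iter _ _) IH gauss_map_theta.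
have termE k : beta_pred k (theta : R) * ln (gauss_iter k theta)^-1 =
    geometric (- ln theta) theta k.
  rewrite itE lnV ?posrE // /geometric /= mulrC; congr (_ * _).
  rewrite /beta_pred (eq_bigr (fun=> theta)) => [|j _]; last exact: itE.
  by rewrite prodr_const_nat subn0.
apply: lime_le.
  apply: is_cvg_nneseries => k _ _; rewrite lee_fin termE.
  by rewrite mulr_ge0 ?exprn_ge0 ?ltW // oppr_gt0.
apply: nearW => n; rewrite sumEFin lee_fin (eq_bigr _ (fun k _ => termE k)).
apply: geometric_le_lim => //; first by rewrite oppr_ge0 ltW.
by rewrite gtr0_norm.
Qed.

(** * Propagation of a global lower bound *)

Lemma brjuno_one_step (R : realType) (a x : R) :
  (forall y : R, gauss_domain y -> (a%:E <= brjuno_fun y)%E) ->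
  gauss_domain x -> ((- ln x + x * a)%:E <= brjuno_fun x)%E.
Proof.
move=> a_lb xX; have [] := xX; rewrite /= in_itv /= => /andP[x0 _] _.
rewrite brjuno_fun_rec // EFinD leeD2l // EFinM lee_pmul2l ?lte_fin //.
exact/a_lb/gauss_domain_map.
Qed.

Lemma brjuno_two_step (R : realType) (a x : R) :
  (forall y : R, gauss_domain y -> (a%:E <= brjuno_fun y)%E) ->
  gauss_domain x -> 1 / 2 < x ->
  ((- ln x - x * ln (x^-1 - 1) + (1 - x) * a)%:E <= brjuno_fun x)%E.
Proof.
move=> a_lb xX xh; have [] := xX; rewrite /= in_itv /= => /andP[x0 x1] _.
rewrite brjuno_fun_rec //.
rewrite (_ : _ + _ = - ln x + x * (- ln (x^-1 - 1) + (x^-1 - 1) * a)); last first.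
  by field; apply: lt0r_neq0.
rewrite EFinD leeD2l // EFinM lee_pmul2l ?lte_fin //.
rewrite -gauss_map_half //; apply: brjuno_one_step => //.
exact: gauss_domain_map.
Qed.

(** On the left of theta the one-step bound multiplies the gap d by
    x <= theta; on the right the two-step bound multiplies it by
    x * (1/x - 1) = 1 - x < 1 - theta < theta.  The one-step bound alone would
    not do, since - ln x + x * brjuno_min drops below brjuno_min just to the
    right of theta. *)
Lemma brjuno_gap_contraction (R : realType) (d : R) : 0 <= d ->
  (forall y : R, gauss_domain y -> ((brjuno_min - d)%:E <= brjuno_fun y)%E) ->
  forall x : R, gauss_domain x ->
    ((brjuno_min - theta * d)%:E <= brjuno_fun x)%E.
Proof.
move=> d0 d_lb x xX; have [] := xX; rewrite /= in_itv /= => /andP[x0 x1] _.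
have /andP[h1 h2] := theta_itv R.
case: (ltgtP x theta) => xt.
- apply: le_trans (brjuno_one_step _ _ _ d_lb xX); rewrite lee_fin.
  have := one_step_bound _ _ x0 xt; nra.
- have xh : 1 / 2 < x by lra.
  apply: le_trans (brjuno_two_step _ _ _ d_lb xX xh); rewrite lee_fin.
  have := two_step_bound _ _ xt x1; nra.
- apply: le_trans (brjuno_one_step _ _ _ d_lb xX); rewrite lee_fin xt.
  have := brjuno_minE R; nra.
Qed.

Lemma brjuno_fun_ge_min (R : realType) (x : R) : gauss_domain x ->
  (brjuno_min%:E <= brjuno_fun x)%E.
Proof.
move=> xX.
have /andP[h1 h2] := theta_itv R; have /andP[m0 _] := brjuno_min_itv R.
have t0 : 0 < (theta : R) by lra.
have lb n : forall y : R, gauss_domain y ->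
    ((brjuno_min - theta ^+ n * brjuno_min)%:E <= brjuno_fun y)%E.
  elim: n => [|n IH] y yX; first by rewrite mul1r subrr brjuno_fun_ge0.
  rewrite exprS -mulrA; apply: brjuno_gap_contraction => //.
  by rewrite mulr_ge0 ?exprn_ge0 ?ltW.
have := brjuno_fun_ge0 _ _ xX.
case E: (brjuno_fun x) => [r| |] //; last by move=> _; rewrite leey.
move=> _; rewrite lee_fin.
have cv : ((fun n : nat => brjuno_min - theta ^+ n * brjuno_min : R) @ \oo
    --> (brjuno_min : R)).
  rewrite -[X in _ --> X]subr0 -[X in _ - X](mul0r brjuno_min).
  apply: cvgB; first exact: cvg_cst.
  by apply: cvgMr_tmp; apply: cvg_expr; rewrite gtr0_norm.
rewrite -(cvg_lim _ cv) //; apply: limr_le; first exact: (cvgP _ cv).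
by apply: nearW => n; rewrite -lee_fin -E lb.
Qed.

Theorem mainTheorem1 (R : realType) (x : R) (hx : brjuno_number x)
  (hxtheta : x <> theta) : (brjuno_fun theta < brjuno_fun x)%E.
Proof.
case: hx => xX _.
have [] := xX; rewrite /= in_itv /= => /andP[x0 x1] _.
have /andP[h1 _] := theta_itv R.
apply: (le_lt_trans (brjuno_fun_theta_le R)).
case: (ltgtP x theta) => // xt.
- apply: lt_le_trans (brjuno_one_step _ _ _ (@brjuno_fun_ge_min R) xX).
  by rewrite lte_fin one_step_bound.
- have xh : 1 / 2 < x by lra.
  apply: lt_le_trans (brjuno_two_step _ _ _ (@brjuno_fun_ge_min R) xX xh).
  by rewrite lte_fin two_step_bound.
Qed.
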